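(* An oriented graph is (isomorphic to) an abstract Burling graph if and only if it is (isomorphic to) an oriented graph derived from a Burling tree. Consequently, the class of underlying graphs of abstract Burling graphs is equal to the class of derived graphs, and therefore to the class of Burling graphs.
   Context: A Burling set is a triple $(S,\prec,\rightarrow)$ where $S$ is a non-empty finite set, $\prec$ is a strict partial order on $S$ (asymmetric and transitive), $\rightarrow$ is a binary relation on $S$ with no directed cycle (no $x_1\rightarrow x_2\rightarrow\dots\rightarrow x_n\rightarrow x_1$ for any $n\ge1$), and for all $x,y,z\in S$: (i) if $x\prec y$ and $x\prec z$ then $y\prec z$ or $z\prec y$; (ii) if $x\rightarrow y$ and $x\rightarrow z$ then $y\prec z$ or $z\prec y$; (iii) if $x\rightarrow y$ and $x\prec z$ then $y\prec z$; (iv) if $x\rightarrow y$ and $y\prec z$ then $x\rightarrow z$ or $x\prec z$. The abstract Burling graph of $(S,\prec,\rightarrow)$ is the oriented graph with vertex set $S$ and an arc $xy$ iff $x\rightarrow y$. A Burling tree is a 4-tuple $(T,r,\lambda,c)$ where $T$ is a rooted tree with root $r$; $\lambda$ assigns to each non-leaf vertex $v$ one of its children, its last-born; $c$ is a function on $V(T)$ with $c(v)$ the vertex set of a (possibly empty) branch (downward path $v_1\dots v_k$, $v_i$ parent of $v_{i+1}$) starting at the last-born of the parent of $v$ when $v\ne r$ is not a last-born, and $c(v)=\varnothing$ when $v$ is a last-born or the root. The oriented graph fully derived from it has vertex set $V(T)$ and arc $uv$ iff $v\in c(u)$; an oriented graph derived from the Burling tree is an induced subgraph of it, and a derived graph is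 the underlying graph of one. Burling sequence: for a graph $G$ and set $\mathcal S$ of stable sets, $\mathrm{next}(G,\mathcal S)=(G',\mathcal S')$ where $G'$ is a copy of $G$ plus, for each $S\in\mathcal S$, a new copy $G_S$ of $G$ (with copy $\mathcal S_S$ of $\mathcal S$) and for each $Q\in\mathcal S_S$ a new vertex $v_{S,Q}$ adjacent exactly to $Q$; $\mathcal S'=\{S\cup Q,\ S\cup\{v_{S,Q}\}: S\in\mathcal S, Q\in\mathcal S_S\}$. With $G_1=K_1$, $\mathcal S_1=\{V(G_1)\}$, $(G_{k+1},\mathcal S_{k+1})=\mathrm{next}(G_k,\mathcal S_k)$; Burling graphs are the graphs isomorphic to induced subgraphs of some $G_k$.
   Formalization: Axioms (i) and (ii) of a Burling set are required only for y ≠ z (with y = z they would give y ≺ y and force both relations to be empty), and graphs are taken to have at least one vertex. *)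

(* Defs.v *)
From mathcomp Require Import all_boot.

Set Implicit Arguments.
Unset Strict Implicit.
Unset Printing Implicit Defensive.

(* Graphs and oriented graphs are finite and have at least one vertex; the
   asymmetry of [arc] excludes loops as well as pairs of opposite arcs. *)
Record sgraph := SGraph {
  svert :> finType;
  adj : rel svert;
  adj_sym : symmetric adj;
  adj_irr : irreflexive adj;
  svert_gt0 : 0 < #|svert| }.

Record ograph := OGraph {
  overt :> finType;
  arc : rel overt;
  arc_asym : forall x y, arc x y -> ~~ arc y x;
  overt_gt0 : 0 < #|overt| }.

Definition under_adj (D : ograph) : rel D := [rel x y | arc x y || arc y x].

Lemma under_sym (D : ograph) : symmetric (@under_adj D).
Proof. by move=> x y; rewrite /under_adj /= orbC. Qed.

Lemma under_irr (D : ograph) : irreflexive (@under_adj D).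
Proof.
move=> x; rewrite /under_adj /= orbb; apply/negbTE/negP => xx.
by move: (arc_asym xx); rewrite xx.
Qed.

Definition underlying (D : ograph) : sgraph :=
  SGraph (@under_sym D) (@under_irr D) (overt_gt0 D).

Definition isomorphic (T U : finType) (e : rel T) (f : rel U) : Prop :=
  exists2 h : T -> U, bijective h & forall x y, f (h x) (h y) = e x y.

Definition induced (T : finType) (e : rel T) (A : {set T}) :
  rel {x : T | x \in A} := [rel x y | e (val x) (val y)].
Arguments induced {T} e A.

(* [bs_i] and [bs_ii] compare two distinct elements: for [y = z] their
   conclusion would contradict the asymmetry of [prec], so that [prec] and
   [arrow] would both be empty. *)
Record burling_set (S : finType) (prec arrow : rel S) : Prop := BurlingSet {
  bs_nonempty : 0 < #|S|;
  bs_prec_asym : forall x y, prec x y -> ~~ prec y x;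
  bs_prec_trans : transitive prec;
  bs_arrow_acyclic : forall s : seq S, s <> [::] -> ~~ cycle arrow s;
  bs_i : forall x y z, prec x y -> prec x z -> y <> z ->
           prec y z \/ prec z y;
  bs_ii : forall x y z, arrow x y -> arrow x z -> y <> z ->
            prec y z \/ prec z y;
  bs_iii : forall x y z, arrow x y -> prec x z -> prec y z;
  bs_iv : forall x y z, arrow x y -> prec y z -> arrow x z \/ prec x z }.

Definition abstract_burling (D : ograph) : Prop :=
  exists (S : finType) (prec arrow : rel S),
    burling_set prec arrow /\ isomorphic (@arc D) arrow.

(* Cycles of a simple graph have length at least 3. *)
Record is_tree (T : finType) (e : rel T) : Prop := IsTree {
  tree_sym : symmetric e;
  tree_irr : irreflexive e;
  tree_connected : forall x y, connect e x y;
  tree_acyclic : forall s : seq T, 2 < size s -> uniq s -> ~~ cycle e s }.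

(* [parent e r u v] : [u] is the vertex preceding [v] on a simple path of [e]
   from [r] to [v]. *)
Definition parent (T : finType) (e : rel T) (r u v : T) : Prop :=
  exists p : seq T,
    [/\ path e r (rcons p v), uniq (r :: rcons p v) & last r p = u].

Fixpoint downward (T : finType) (e : rel T) (r x : T) (s : seq T) : Prop :=
  if s is y :: s' then parent e r x y /\ downward e r y s' else True.

Definition branch_from (T : finType) (e : rel T) (r x : T) (s : seq T) : Prop :=
  if s is y :: s' then y = x /\ downward e r y s' else True.

(* [lam] is total, but its values at the leaves are never used. *)
Definition last_born (T : finType) (e : rel T) (r : T) (lam : T -> T) (v : T) :
  Prop := exists2 u, parent e r u v & lam u = v.

Record burling_tree (T : finType) (e : rel T) (r : T) (lam : T -> T)
    (c : T -> {set T}) : Prop := BurlingTree {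
  bt_tree : is_tree e;
  bt_lam : forall u, (exists v, parent e r u v) -> parent e r u (lam u);
  bt_c : forall u v, parent e r u v -> ~ last_born e r lam v ->
           exists2 s, branch_from e r (lam u) s & c v = [set x in s];
  bt_c0 : forall v, v = r \/ last_born e r lam v -> c v = set0 }.

Definition fully_derived (T : finType) (c : T -> {set T}) : rel T :=
  [rel u v | v \in c u].

Definition derived_ograph (D : ograph) : Prop :=
  exists (T : finType) (e : rel T) (r : T) (lam : T -> T) (c : T -> {set T}),
    burling_tree e r lam c /\
    exists A : {set T}, isomorphic (@arc D) (induced (fully_derived c) A).

Definition abstract_burling_underlying (G : sgraph) : Prop :=
  exists2 D : ograph, abstract_burling D &
    isomorphic (@adj G) (@adj (underlying D)).

Definition derived_graph (G : sgraph) : Prop :=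
  exists2 D : ograph, derived_ograph D &
    isomorphic (@adj G) (@adj (underlying D)).

Record bpair := BPair {
  bvert : finType;
  badj : rel bvert;
  bstab : {set {set bvert}} }.

Section Next.
Variable P : bpair.
Local Notation V := (bvert P).
Let stabT : finType := {S : {set V} | S \in bstab P}.

Definition next_vert : finType := (V + stabT * V + stabT * stabT)%type.

Definition in_base (x : V) : next_vert := inl (inl x).
Definition in_copy (S : stabT) (x : V) : next_vert := inl (inr (S, x)).
Definition new_vert (S Q : stabT) : next_vert := inr (S, Q).

Definition next_adj : rel next_vert := fun a b =>
  match a, b with
  | inl (inl x), inl (inl y) => badj x y
  | inl (inr (R, x)), inl (inr (R', y)) => (R == R') && badj x y
  | inr (R, Q), inl (inr (R', x)) => (R == R') && (x \in val Q)
  | inl (inr (R', x)), inr (R, Q) => (R == R') && (x \in val Q)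
  | _, _ => false
  end.

Definition next_stab : {set {set next_vert}} :=
  [set in_base @: val S :|: in_copy S @: val Q | S : stabT, Q : stabT] :|:
  [set in_base @: val S :|: [set new_vert S Q] | S : stabT, Q : stabT].

Definition next_pair : bpair := BPair next_adj next_stab.
End Next.

Definition burling_seq1 : bpair :=
  @BPair unit [rel x y | false] [set [set: unit]].

(* [burling_seq k] is the pair (G_(k+1), S_(k+1)). *)
Fixpoint burling_seq (k : nat) : bpair :=
  if k is k'.+1 then next_pair (burling_seq k') else burling_seq1.

Definition burling_graph (G : sgraph) : Prop :=
  exists (k : nat) (A : {set bvert (burling_seq k)}),
    isomorphic (@adj G) (induced (@badj (burling_seq k)) A).

(* Main.v *)
Require Import Defs.
From mathcomp Require Import all_boot.

Set Implicit Arguments.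
Unset Strict Implicit.
Unset Printing Implicit Defensive.

(* All three classes are compared through Burling sets. In a Burling tree,
   "being a proper descendant of" is a partial order that makes the choice
   function [c] the arrow of a Burling set. Conversely, in a Burling set the
   relation [prec] is a forest, and the out-neighbours of [x] form a downward
   path of it that starts at a sibling of [x]; replacing the children of each
   vertex by a caterpillar, ordered along the acyclic relation [arrow], makes
   every such path start at a last-born. On the side of the Burling sequence,
   each [G_k] carries a Burling set in which the chosen stable sets are chains
   closed upwards. Conversely a Burling set embeds into some [G_k] so that its
   upward closed chains are traces of chosen stable sets: remove a root [s]
   without in-neighbours, embed separately what lies below [s] and the rest,
   and glue the two in two steps of the sequence. *)

(** * Induced copies, ranks of acyclic relations, pullbacks of Burling sets *)

Lemma isomorphic_induced (T U : finType) (e : rel T) (f : rel U) :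
  (exists A : {set U}, isomorphic e (induced f A)) <->
  (exists2 g : T -> U, injective g & forall x y, f (g x) (g y) = e x y).
Proof.
split=> [[A [h hbij hE]] | [g gI gE]].
  exists (val \o h) => [|x y]; last exact: hE.
  by apply: inj_comp val_inj (bij_inj hbij).
have gA x : g x \in [set g z | z : T] by apply: imset_f.
exists [set g z | z : T].
exists (fun x => exist _ (g x) (gA x) : {u | u \in _}) => [|x y];
  last exact: gE.
apply: inj_card_bij => [x y /(congr1 val) /= /gI //|].
by rewrite card_sig card_imset.
Qed.

Section AcyclicRank.
Variables (T : finType) (e : rel T).

Lemma rank_acyclic (f : T -> nat) :
  (forall x y, e x y -> f x < f y) -> forall s, s <> [::] -> ~~ cycle e s.
Proof.
move=> fE [|x s] // _; apply/negP => /=.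
suff H : forall y, path e y (rcons s x) -> f y < f x.
  by move/H; rewrite ltnn.
elim: s => [|z s IH] y /=; first by rewrite andbT; apply: fE.
by case/andP => /fE yz /IH; apply: ltn_trans.
Qed.

Lemma acyclic_cons (acyc : forall s, s <> [::] -> ~~ cycle e s) x s :
  ~~ cycle e (x :: s).
Proof. exact: acyc. Qed.

Lemma acyclic_rank : (forall s, s <> [::] -> ~~ cycle e s) ->
  exists f : T -> 'I_#|T|, forall x y, e x y -> f x < f y.
Proof.
(* The rank of [x] counts the vertices other than [x] that reach [x]; leaving [x] out keeps it below
   [#|T|] and makes it grow strictly along [e]. *)
move=> acyc; pose A x := [set y | connect e y x] :\ x.
have Alt x : #|A x| < #|T|.
  by rewrite -cardsT (cardsD1 x [set: T]) inE ltnS subset_leq_card ?setSD.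
exists (fun x => Ordinal (Alt x)) => x y exy /=.
have Nyx : ~~ connect e y x.
  apply/negP => /connectP [p yp xE]; case/negP: (acyclic_cons acyc y p).
  by rewrite /= rcons_path yp -xE.
have xy : x != y by apply: contraNneq Nyx => ->.
apply: proper_card; apply/properP; split.
  apply/subsetP => z; rewrite !inE => /andP [_ zx].
  rewrite (connect_trans zx (connect1 exy)) andbT.
  by apply: contraNneq Nyx => <-.
by exists x; rewrite !inE ?eqxx // xy connect1.
Qed.
End AcyclicRank.

Lemma burling_set_inj (T U : finType) (g : T -> U) (prec arrow : rel U)
    (e : rel T) :
  0 < #|T| -> injective g -> (forall x y, arrow (g x) (g y) = e x y) ->
  burling_set prec arrow -> burling_set (relpre g prec) e.
Proof.
move=> T0 gI gE [_ asy tr acyc i ii iii iv]; split=> //=.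
- by move=> x y; apply: asy.
- by move=> y x z; apply: tr.
- case=> [//|x s] _; rewrite -(@eq_cycle _ (relpre g arrow)) // -cycle_map.
  exact: acyclic_cons.
- by move=> x y z xy xz yz; apply: (i _ _ _ xy xz) => /gI.
- by move=> x y z; rewrite -!gE => xy xz yz; apply: (ii _ _ _ xy xz) => /gI.
- by move=> x y z; rewrite -gE; apply: iii.
- by move=> x y z; rewrite -!gE; apply: iv.
Qed.

Section BurlingSetTheory.
Variables (S : finType) (prec arrow : rel S).
Hypothesis bs : burling_set prec arrow.

Lemma prec_irr x : prec x x = false.
Proof. by apply/negP => xx; move: (bs_prec_asym bs xx); rewrite xx. Qed.

Lemma arrow_irr x : arrow x x = false.
Proof.
have := acyclic_cons (bs_arrow_acyclic bs) x [::].
by rewrite /= andbT => /negbTE.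
Qed.

Lemma arrow_asym x y : arrow x y -> ~~ arrow y x.
Proof.
move=> xy; apply/negP => yx.
have := acyclic_cons (bs_arrow_acyclic bs) x [:: y].
by rewrite /= xy yx.
Qed.

Lemma arrow_nprec_sym x y : arrow x y -> prec y x = false.
Proof.
move=> xy; apply/negP => /(bs_iv bs xy).
by rewrite arrow_irr prec_irr => -[].
Qed.
End BurlingSetTheory.

(** * The Burling sequence carries Burling sets *)

(** Upward closure is relative to [A], so that a chain can be cut down to the pieces into which [A]
    is split later. *)
Definition up_chain (T : finType) (prec : rel T) (A C : {set T}) : Prop :=
  [/\ C \subset A,
      forall x y, x \in C -> y \in C -> x != y -> prec x y || prec y x &
      forall x y, x \in C -> prec x y -> y \in A -> y \in C].

Section NextBurling.
Variables (P : bpair) (prec arrow : rel (bvert P)).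
Hypothesis bs : burling_set prec arrow.
Hypothesis chP : forall Q, Q \in bstab P -> up_chain prec setT Q.
Local Notation stabT := {S : {set bvert P} | S \in bstab P}.

(** The copy attached to [R] and its new vertices hang below the members of [R]; this turns both
    kinds of new stable sets into chains. *)
Definition next_prec : rel (next_vert P) := fun a b =>
  match a, b with
  | inl (inl x), inl (inl y) => prec x y
  | inl (inr (R, x)), inl (inr (R', y)) => (R == R') && prec x y
  | inl (inr (R, x)), inl (inl y) => y \in val R
  | inr (R, Q), inl (inl y) => y \in val R
  | _, _ => false
  end.

Definition next_arrow : rel (next_vert P) := fun a b =>
  match a, b with
  | inl (inl x), inl (inl y) => arrow x y
  | inl (inr (R, x)), inl (inr (R', y)) => (R == R') && arrow x y
  | inr (R, Q), inl (inr (R', x)) => (R == R') && (x \in val Q)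
  | _, _ => false
  end.

Lemma stab_chain (R : stabT) x y :
  x \in val R -> y \in val R -> x <> y -> prec x y \/ prec y x.
Proof.
by case: (chP (valP R)) => _ ch _ xR yR /eqP xy; apply/orP; apply: ch.
Qed.

Lemma stab_up (R : stabT) x y : x \in val R -> prec x y -> y \in val R.
Proof. by case: (chP (valP R)) => _ _ up xR xy; apply: up xy _. Qed.

(** Inside one copy the axioms are inherited. In the nontrivial mixed cases, (i) and (ii) come from
    stable sets being chains, transitivity and (iv) from their upward closure. *)
Lemma next_burling_set : burling_set next_prec next_arrow.
Proof.
split.
- have /card_gt0P [x _] := bs_nonempty bs.
  by apply/card_gt0P; exists (inl (inl x)).
- move=> [[x|[R x]]|[R Q]] [[y|[R' y]]|[R' Q']] //=.
    exact: bs_prec_asym bs _ _.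
  by case/andP => /eqP -> /(bs_prec_asym bs); rewrite eqxx.
- move=> [[y|[R y]]|[R Q]] [[x|[R' x]]|[R' Q']] [[z|[R'' z]]|[R'' Q'']] //=.
  + exact: bs_prec_trans bs _ _ _.
  + exact: stab_up.
  + exact: stab_up.
  + by case/andP => /eqP ->.
  + case/andP => /eqP -> xy /andP [/eqP -> /(bs_prec_trans bs xy) ->].
    by rewrite eqxx.
- have [f fE] := acyclic_rank (bs_arrow_acyclic bs).
  pose g (v : next_vert P) := match v with
    | inl (inl x) | inl (inr (_, x)) => (f x).+1 | inr _ => 0 end.
  apply: (@rank_acyclic _ _ g) => [[[x|[R x]]|[R Q]] [[y|[R' y]]|[R' Q']]] //=.
    by move/fE.
  by case/andP => _ /fE.
- move=> [[x|[R x]]|[R Q]] [[y|[R' y]]|[R' Q']] [[z|[R'' z]]|[R'' Q'']] //=.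
  + by move=> xy xz yz; apply: (bs_i bs xy xz) => E; apply: yz; rewrite E.
  + by move=> xy xz yz; apply: (stab_chain xy xz) => E; apply: yz; rewrite E.
  + by move=> xy /andP [/eqP <- _] _; right.
  + by move=> /andP [/eqP <- _] xy _; left.
  + move=> /andP [/eqP <- xy] /andP [/eqP <- xz]; rewrite !eqxx => yz.
    by apply: (bs_i bs xy xz) => E; apply: yz; rewrite E.
  + by move=> xy xz yz; apply: (stab_chain xy xz) => E; apply: yz; rewrite E.
- move=> [[x|[R x]]|[R Q]] [[y|[R' y]]|[R' Q']] [[z|[R'' z]]|[R'' Q'']] //=.
  + by move=> xy xz yz; apply: (bs_ii bs xy xz) => E; apply: yz; rewrite E.
  + move=> /andP [/eqP <- xy] /andP [/eqP <- xz]; rewrite !eqxx => yz.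
    by apply: (bs_ii bs xy xz) => E; apply: yz; rewrite E.
  + move=> /andP [/eqP <- xy] /andP [/eqP <- xz]; rewrite !eqxx => yz.
    by apply: (stab_chain xy xz) => E; apply: yz; rewrite E.
- move=> [[x|[R x]]|[R Q]] [[y|[R' y]]|[R' Q']] [[z|[R'' z]]|[R'' Q'']] //=.
  + exact: bs_iii bs _ _ _.
  + by case/andP => /eqP ->.
  + by case/andP => /eqP -> xy /andP [-> /(bs_iii bs xy)].
  + by case/andP => /eqP ->.
- move=> [[x|[R x]]|[R Q]] [[y|[R' y]]|[R' Q']] [[z|[R'' z]]|[R'' Q'']] //=.
  + exact: bs_iv bs _ _ _.
  + by case/andP => /eqP -> _; right.
  + by case/andP => /eqP -> xy /andP [-> /(bs_iv bs xy)].
  + by case/andP => /eqP -> _; right.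
  + by case/andP => /eqP -> xQ /andP [-> /(stab_up xQ)]; left.
Qed.

Lemma next_adj_arrow : (forall x y, badj x y = arrow x y || arrow y x) ->
  forall x y, @next_adj P x y = next_arrow x y || next_arrow y x.
Proof.
move=> adjE [[x|[R x]]|[R Q]] [[y|[R' y]]|[R' Q']] //=.
- by rewrite adjE (eq_sym R') -andb_orr.
- by rewrite orbF.
Qed.

Lemma next_up_chain Q : Q \in next_stab P -> up_chain next_prec setT Q.
Proof.
have memB (R : stabT) (B : {set next_vert P}) v :
    v \in [set in_base y | y in val R] :|: B ->
    v \in B \/ exists2 x, x \in val R & v = in_base x.
  by rewrite inE => /orP [/imsetP|]; [right | left].
(* Both kinds of stable sets consist of a base copy of [val R] and a chain [B] lying below it. *)
have chain (R : stabT) (B : {set next_vert P}) :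
    (forall x y, x \in B -> y \in B -> x != y ->
       next_prec x y || next_prec y x) ->
    (forall x, x \in B -> forall y, y \in val R -> next_prec x (in_base y)) ->
    (forall x y, x \in B -> next_prec x y ->
       y \in B \/ exists2 y', y' \in val R & y = in_base y') ->
    up_chain next_prec setT ([set in_base y | y in val R] :|: B).
  move=> chB BR upB; split=> [|x y|x y]; first exact: subsetT.
    move=> /memB [xB|[x' xR ->]] /memB [yB|[y' yR ->]].
    + exact: chB.
    + by rewrite (BR _ xB).
    + by rewrite (BR _ yB) ?orbT.
    + move=> xy; apply/orP; apply: (stab_chain xR yR) => E.
      by rewrite E eqxx in xy.
  move=> /memB [xB|[x' xR ->]] xy _.
    case: (upB _ _ xB xy) => [yB|[y' yR ->]]; first by rewrite inE yB orbT.
    by rewrite inE imset_f.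
  case: y xy => [[y|[R' y]]|[R' Q']] //= xy.
  by rewrite inE imset_f // (stab_up xR xy).
rewrite inE => /orP [] /imset2P [R Q' _ _ ->].
  apply: chain => [_ _ /imsetP [x xQ ->] /imsetP [y yQ ->] xy||].
  + rewrite /= !eqxx; apply/orP; apply: (stab_chain xQ yQ) => E.
    by rewrite E eqxx in xy.
  + by move=> _ /imsetP [x xQ ->].
  + move=> _ [[y|[R' y]]|[R' Q'']] /imsetP [x xQ ->] //= xy.
      by right; exists y.
    by case/andP: xy => /eqP <- xy; left; rewrite imset_f // (stab_up xQ xy).
apply: chain => [x y /set1P -> /set1P ->||].
- by rewrite eqxx.
- by move=> x /set1P ->.
- by move=> x [[y|[R' y]]|[R' Q'']] /set1P -> //= xy; right; exists y.
Qed.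
End NextBurling.

Lemma burling_seq_burling_set k :
  exists prec arrow : rel (bvert (burling_seq k)),
    [/\ burling_set prec arrow,
        forall x y, badj x y = arrow x y || arrow y x &
        forall Q, Q \in bstab (burling_seq k) -> up_chain prec setT Q].
Proof.
elim: k => [|k [prec [arrow [bs adjE chP]]]].
  exists (fun _ _ => false), (fun _ _ => false); split=> //.
    split=> //; first by rewrite card_unit.
    by move=> s; apply: (@rank_acyclic _ _ (fun=> 0)).
exists (next_prec prec), (next_arrow arrow); split.
- exact: next_burling_set.
- exact: next_adj_arrow.
- exact: next_up_chain.
Qed.

(** * Burling sets embed into the Burling sequence *)

Definition stab_elt (P : bpair) (Q : {set bvert P}) (QP : Q \in bstab P) :
  {Q : {set bvert P} | Q \in bstab P} := exist _ Q QP.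

Section Embedding.
Variables (S : finType) (prec arrow : rel S).
Hypothesis bs : burling_set prec arrow.

(** The trace condition strengthens the induction: such a trace later becomes the neighbourhood of a
    new vertex. *)
Definition stab_embedding (A : {set S}) (P : bpair) (g : S -> bvert P) : Prop :=
  [/\ {in A &, injective g},
      {in A &, forall x y, badj (g x) (g y) = arrow x y || arrow y x} &
      forall C, up_chain prec A C ->
        exists2 Q, Q \in bstab P & {in A, forall x, (g x \in Q) = (x \in C)}].

Lemma up_chain0 (A : {set S}) : up_chain prec A set0.
Proof. by split=> [|x y|x y]; rewrite ?sub0set ?inE. Qed.

Lemma in_base_cup P (R : {set bvert P}) (B : {set next_vert P}) x :
  (forall y, in_base y \notin B) ->
  (in_base x \in [set in_base y | y in R] :|: B) = (x \in R).
Proof.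
move=> nB; rewrite inE (negbTE (nB x)) orbF mem_imset //.
by move=> u v [].
Qed.

Lemma next_cup_stab P (R Q : {Q : {set bvert P} | Q \in bstab P}) :
  [set in_base x | x in val R] :|: [set in_copy R x | x in val Q]
    \in bstab (next_pair P).
Proof. by rewrite inE; apply/orP; left; apply: imset2_f. Qed.

Lemma next_new_stab P (R Q : {Q : {set bvert P} | Q \in bstab P}) :
  [set in_base x | x in val R] :|: [set new_vert R Q]
    \in bstab (next_pair P).
Proof. by rewrite inE; apply/orP; right; apply: imset2_f. Qed.

Lemma stab_embedding_next A P g :
  @stab_embedding A P g ->
  @stab_embedding A (next_pair P) (fun x => in_base (g x)).
Proof.
case=> gI gE gC; split=> [x y xA yA [] /gI -> // | // | C /gC [Q QP QE]].
pose R := stab_elt QP.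
(* The second index is arbitrary: the added vertex lies outside the image, so the trace is
   unchanged. *)
exists ([set in_base x | x in val R] :|: [set new_vert R R]).
  exact: next_new_stab.
by move=> x xA; rewrite in_base_cup ?QE // => y; rewrite inE.
Qed.

Lemma stab_embedding_leq A k m g : k <= m ->
  @stab_embedding A (burling_seq k) g ->
  exists g', @stab_embedding A (burling_seq m) g'.
Proof.
move=> /subnK <-; elim: (m - k) => [|d IH] gP; first by exists g.
have [g' g'P] := IH gP; exists (fun x => in_base (g' x)).
exact: stab_embedding_next.
Qed.

Section Root.
Variables (A : {set S}) (s : S).
Hypothesis sA : s \in A.
Hypothesis s_root : forall x, x \in A -> ~~ prec s x.
Hypothesis s_source : forall x, x \in A -> ~~ arrow x s.

Let B := [set x in A | prec x s].
Let R := [set x in A | (x != s) && ~~ prec x s].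

Lemma root_cases x : x \in A -> [|| x == s, x \in B | x \in R].
Proof. by move=> xA; rewrite !inE xA /=; case: eqP; case: prec. Qed.

(** An arrow from [B] to [R] would have its head below [s] by (iii); for one from [R] to [B], (iv)
    would give an arrow into [s] or put its tail below [s]. *)
Lemma below_arrow x y : x \in B -> y \in R -> arrow x y || arrow y x = false.
Proof.
rewrite !inE => /andP [xA xs] /and3P [yA ys /negP nys].
apply/negP => /orP [/(bs_iii bs)/(_ xs) // | /(bs_iv bs)/(_ xs) []//].
by move=> yas; case/negP: (s_source yA).
Qed.

Lemma root_arrow x : x \in B -> arrow x s || arrow s x = false.
Proof.
rewrite !inE => /andP [xA xs]; rewrite (negbTE (s_source xA)) /=.
by apply/negP => /(arrow_nprec_sym bs); rewrite xs.
Qed.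

(** The future neighbours of [s] in [R]: (ii) makes them a chain, and (iv) closes them upwards
    because nothing in [A] lies above [s]. *)
Lemma root_up_chain : up_chain prec R [set y in R | arrow s y].
Proof.
split; first by apply/subsetP => x; rewrite inE => /andP [].
  move=> x y; rewrite !inE => /andP [_ sx] /andP [_ sy] /eqP xy.
  by apply/orP; apply: (bs_ii bs sx sy).
move=> x y; rewrite !inE => /andP [_ sx] xy yR; rewrite yR /=.
case: (bs_iv bs sx xy) => // sy.
by case/andP: yR => /s_root; rewrite sy.
Qed.

(** Members of [C] are comparable with the maximal element [s], hence equal to it or below it. *)
Lemma up_chain_root C : up_chain prec A C -> s \in C ->
  up_chain prec B (C :&: B) /\ C :&: R = set0.
Proof.
case=> /subsetP CA ch up sC; split.
  split; first exact: subsetIr.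
    by move=> x y /setIP [xC _] /setIP [yC _]; apply: ch.
  move=> x y /setIP [xC _] xy yB; apply/setIP; split=> //.
  by apply: up xC xy _; move: yB; rewrite inE => /andP [].
apply/setP => x; rewrite !inE; apply/negP => /and4P [xC xA xs /negP[]].
by have := ch _ _ xC sC xs; rewrite (negbTE (s_root xA)) orbF.
Qed.

Lemma up_chain_nroot C : up_chain prec A C -> s \notin C -> up_chain prec R C.
Proof.
case=> /subsetP CA ch up sC; split=> //.
  apply/subsetP => x xC; rewrite inE CA //=; apply/andP; split.
    by apply: contraNneq sC => <-.
  by apply: contraNN sC => /(up _ _ xC); apply.
move=> x y xC xy yR; apply: up xC xy _.
by move: yR; rewrite inE => /andP [].
Qed.

(* The part [R] goes into a copy attached to some stable set [Q0] of the first
   [next], [s] becomes the new vertex of that copy whose neighbourhood traces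
   the out-neighbours of [s], and the part [B] below [s] goes into the copy
   that the second [next] attaches to [Q0] extended by [s]. *)
Lemma stab_embedding_root k gB gR :
  @stab_embedding B (burling_seq k) gB ->
  @stab_embedding R (burling_seq k) gR ->
  exists g, @stab_embedding A (burling_seq k.+2) g.
Proof.
(* The embedding of [B] is lifted by one index, since the second [next] copies [next_pair P] and not
   [P]. *)
move=> /stab_embedding_next [gBI gBE gBC] [gRI gRE gRC].
set P := burling_seq k in gRI gRE gRC gBI gBE gBC *.
pose gB' x : bvert (next_pair P) := in_base (gB x).
(* The empty chain serves to produce some member of [bstab P]. *)
have [Q0 Q0P _] := gRC _ (up_chain0 R).
have [Q1 Q1P Q1E] := gRC _ root_up_chain.
pose q0 := stab_elt Q0P.
pose q1 := stab_elt Q1P.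
pose t0 := stab_elt (next_new_stab q0 q1).
pose g x : bvert (burling_seq k.+2) :=
  if x == s then @in_base (next_pair P) (new_vert q0 q1)
  else if x \in B then @in_copy (next_pair P) t0 (gB' x)
  else @in_base (next_pair P) (in_copy q0 (gR x)).
have gs : g s = @in_base (next_pair P) (new_vert q0 q1) by rewrite /g eqxx.
have gBx x : x \in B -> g x = @in_copy (next_pair P) t0 (gB' x).
  move=> xB; rewrite /g xB; case: eqP => // xs.
  by move: xB; rewrite xs inE (prec_irr bs) andbF.
have gRx x : x \in R -> g x = @in_base (next_pair P) (in_copy q0 (gR x)).
  by rewrite inE /g inE => /and3P [-> /negbTE-> /negbTE->].
have BR x : x \in R -> x \notin B by rewrite !inE => /and3P [-> _ ->].
exists g; split.
- move=> x y /root_cases/or3P [/eqP->|xB|xR] /root_cases/or3P [/eqP->|yB|yR] //;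
    rewrite ?gs; try rewrite (gBx _ xB); try rewrite (gBx _ yB);
    try rewrite (gRx _ xR); try rewrite (gRx _ yR); move=> // E.
  + by apply: gBI => //; case: E => ->.
  + by apply: gRI => //; case: E => ->.
- move=> x y /root_cases/or3P [/eqP->|xB|xR] /root_cases/or3P [/eqP->|yB|yR] //;
    rewrite ?gs; try rewrite (gBx _ xB); try rewrite (gBx _ yB);
    try rewrite (gRx _ xR); try rewrite (gRx _ yR); rewrite //=.
  + by rewrite (arrow_irr bs).
  + by rewrite orbC root_arrow.
  + rewrite eqxx Q1E // inE yR /= (negbTE (s_source _)) ?orbF //.
    by move: yR; rewrite inE => /andP [].
  + by rewrite root_arrow.
  + by rewrite eqxx; apply: gBE.
  + by rewrite below_arrow.
  + rewrite eqxx Q1E // inE xR /= (negbTE (s_source _)) //.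
    by move: xR; rewrite inE => /andP [].
  + by rewrite orbC below_arrow.
  + by rewrite eqxx; apply: gRE.
(* If [s] is in [C], the base part [t0] contributes exactly [s] to the trace, and the copy attached
   to [t0] supplies the trace on [B]. *)
- move=> C chC; have [sC|sC] := boolP (s \in C).
    have [chB CR] := up_chain_root chC sC; have [Q QP QE] := gBC _ chB.
    pose q := stab_elt QP.
    exists ([set in_base x | x in val t0] :|: [set in_copy t0 x | x in val q]).
      exact: next_cup_stab.
    have nB v : in_base v \notin [set in_copy t0 x | x in val q].
      by apply/imsetP => -[].
    move=> x /root_cases/or3P [/eqP->|xB|xR].
    + by rewrite gs in_base_cup // sC !inE eqxx orbT.
    + rewrite gBx // inE mem_imset => [|u v [] //]; rewrite QE // inE xB andbT.
      by rewrite orbC; case: imsetP => [[] //|]; rewrite orbF.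
    + rewrite gRx // in_base_cup // !inE /= orbF.
      have := in_set0 x; rewrite -CR inE xR andbT => ->.
      by apply/imsetP => -[].
(* Otherwise [C] lies in [R]: the part of [t] in the copy attached to [q0] traces it, and the added
   [new_vert t t] is outside the image. *)
have [Q QP QE] := gRC _ (up_chain_nroot chC sC).
pose q := stab_elt QP.
pose t := stab_elt (next_cup_stab q0 q).
exists ([set in_base x | x in val t] :|: [set new_vert t t]).
  exact: next_new_stab.
have nB v : in_base v \notin [set new_vert t t] by rewrite inE.
have [/subsetP CR _ _] := up_chain_nroot chC sC.
move=> x /root_cases/or3P [/eqP->|xB|xR].
+ rewrite gs in_base_cup // (negbTE sC) inE.
  by apply/norP; split; apply/imsetP => -[].
+ rewrite gBx // !inE orbF.
  have -> : x \in C = false by apply: contraTF xB => /CR/BR.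
  by apply/imsetP => -[].
+ rewrite gRx // in_base_cup // inE mem_imset => [|u v [] //].
  by rewrite QE // orbC; case: imsetP => [[] //|]; rewrite orbF.
Qed.
End Root.

Lemma stab_embedding_exists (A : {set S}) :
  exists k (g : S -> bvert (burling_seq k)),
    @stab_embedding A (burling_seq k) g.
Proof.
have [f fE] := acyclic_rank (bs_arrow_acyclic bs).
have [n] := ubnP #|A|; elim: n A => // n IH A; rewrite ltnS => An.
pose up x := [set y in A | prec x y].
have [x0 x0A|A0] := pickP (mem A); last first.
  exists 0, (fun=> tt); split=> [x y|x y|C _].
  - by move=> xA; have := A0 x; rewrite /= xA.
  - by move=> xA; have := A0 x; rewrite /= xA.
  exists setT; first by rewrite inE.
  by move=> x xA; have := A0 x; rewrite /= xA.
have [r0 r0A r0root] : exists2 x, x \in A & [forall y in A, ~~ prec x y].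
  case: (@arg_minnP _ x0 (mem A) (fun x => #|up x|) x0A) => x xA xmin.
  exists x => //; apply/forall_inP => y yA; apply/negP => xy.
  have := xmin y yA; apply/negP; rewrite -ltnNge; apply: proper_card.
  apply/properP; split; last by exists y; rewrite !inE ?yA // (prec_irr bs).
  apply/subsetP => z; rewrite !inE => /andP [-> yz].
  exact: bs_prec_trans bs _ _ _ xy yz.
pose root x := (x \in A) && [forall y in A, ~~ prec x y].
have r0P : root r0 by rewrite /root r0A.
(* A maximal element of least rank is a source: by (iii) the tail of an arrow into [s] would be
   maximal too, with smaller rank. *)
case: (@arg_minnP _ r0 root f r0P) => s /andP [sA /forall_inP s_root] smin.
have s_source x : x \in A -> ~~ arrow x s.
  move=> xA; apply/negP => xs.
  have /smin : root x.
    rewrite /root xA; apply/forall_inP => y yA; apply/negP => /(bs_iii bs xs).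
    by apply/negP; apply: s_root.
  by apply/negP; rewrite -ltnNge fE.
have ltA (D : {set S}) : D \subset A :\ s -> #|D| < n.
  move=> /subset_leq_card; rewrite -ltnS; move/leq_trans; apply.
  by rewrite (cardsD1 s) sA in An.
have [|kB [gB gBP]] := IH [set x in A | prec x s].
  apply/ltA/subsetP => x; rewrite !inE => /andP [-> xs].
  by rewrite andbT; apply: contraTneq xs => ->; rewrite (prec_irr bs).
have [|kR [gR gRP]] := IH [set x in A | (x != s) && ~~ prec x s].
  by apply/ltA/subsetP => x; rewrite !inE => /and3P [-> ->].
have [gB' gB'P] := stab_embedding_leq (leq_maxl kB kR) gBP.
have [gR' gR'P] := stab_embedding_leq (leq_maxr kB kR) gRP.
exists (maxn kB kR).+2; exact: stab_embedding_root gB'P gR'P.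
Qed.
End Embedding.

(** * From Burling trees to Burling sets *)

Section Prefix.
Variable T : eqType.
Implicit Types s t w : seq T.

Lemma prefix_comparable s t w :
  prefix s w -> prefix t w -> prefix s t || prefix t s.
Proof.
elim: s t w => [|a s IH] [|b t] [|d w] //=; rewrite ?prefix0s //.
by case/andP => /eqP -> sw /andP [/eqP -> tw]; rewrite !eqxx; apply: IH sw tw.
Qed.

Lemma prefix_anti s t : prefix s t -> prefix t s -> s = t.
Proof.
move=> /prefixP [w ->] /size_prefix; rewrite size_cat.
by case: w => [|a w]; rewrite ?cats0 //= addnS ltnNge leq_addr.
Qed.

Lemma prefix_cat_cases s t w : prefix s (t ++ w) ->
  prefix s t \/ exists2 w', w' != [::] & prefix w' w /\ s = t ++ w'.
Proof.
elim: t s => [|a t IH] [|b s] /=; rewrite ?prefix0s; try by left.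
  by move=> sw; right; exists (b :: s).
case/andP => /eqP -> /IH [->|[w' w'0 [w'w ->]]]; first by left; rewrite eqxx.
by right; exists w'.
Qed.
End Prefix.

Section TreePaths.
Variables (T : finType) (e : rel T).
Hypothesis eT : is_tree e.

(* Two simple paths leaving [r] through different neighbours [a] and [b] join
   [a] to [r] without the edge [ra], which then closes a cycle. *)
Lemma tree_path_uniq r p q :
  path e r p -> uniq (r :: p) -> path e r q -> uniq (r :: q) ->
  last r p = last r q -> p = q.
Proof.
elim: p r q => [|a p IH] r [|b q] //=.
- by move=> _ _ _ /andP [rq _] E; rewrite {1}E mem_last in rq.
- by move=> _ /andP [rq _] _ _ E; rewrite -{1}E mem_last in rq.
case/andP=> ra pa /andP [rap uap] /andP [rb pb] /andP [rbq ubq] E.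
have [ab|ab] := eqVneq a b.
  by rewrite -ab in pb ubq E *; rewrite (IH a q).
exfalso.
pose e' x y := e x y && ~~ ((x == r) && (y == a) || (x == a) && (y == r)).
have e'sym : symmetric e'.
  move=> x y; rewrite /e' (tree_sym eT) orbC.
  by rewrite (andbC (y == r)) (andbC (y == a)).
have sub z s : r \notin z :: s -> path e z s -> path e' z s.
  elim: s z => [|c s IHs] z //=; rewrite inE => /norP [rz] /[dup] rcs.
  rewrite inE => /norP [rc _].
  case/andP=> zc pc; rewrite IHs // andbT.
  by rewrite /e' zc [z == r]eq_sym [c == r]eq_sym (negbTE rz) (negbTE rc) andbF.
have ca : connect e' a (last a p) by apply/connectP; exists p => //; apply: sub.
have cb : connect e' r (last b q).
  apply/connectP; exists (b :: q) => //=; rewrite sub // andbT /e' rb eqxx /=.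
  rewrite (eq_sym b) (negbTE ab) /= (eq_sym b).
  by move: rbq; rewrite inE negb_or => /andP [/negbTE-> _]; rewrite andbF.
have : connect e' a r.
  by apply: connect_trans ca _; rewrite E (sym_connect_sym e'sym).
case/connectP => s0 /shortenP [s ps us _] ls.
have pes : path e a s by apply: sub_path ps => x y /andP [].
have ra' : r != a by move: rap; rewrite inE negb_or => /andP [].
(* The path [s] from [a] to [r] is neither empty nor the removed edge, so with that edge it closes a
   cycle of length at least 3. *)
case: s ps us ls pes => [|x [|y s]] //=.
- by move=> _ _ E'; rewrite E' eqxx in ra'.
- by rewrite andbT /e' => /andP [_ H] _ E'; move: H; rewrite -E' !eqxx orbT.
- move=> _ us ls /and3P [ax xy ys].
  have /negP := @tree_acyclic _ _ eT [:: a, x, y & s] isT us; apply.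
  by rewrite /= ax xy rcons_path ys -ls.
Qed.

Variable r : T.

Lemma tree_path_exists v :
  exists p, [&& path e r p, uniq (r :: p) & last r p == v].
Proof.
have /connectP [p0 /shortenP [p pp up _] ->] := tree_connected eT r v.
by exists p; rewrite pp up eqxx.
Qed.

(** The start [r] is left out, so that the length is the depth; ancestors become prefixes. *)
Definition root_path v : seq T := xchoose (tree_path_exists v).

Lemma root_pathP v :
  [/\ path e r (root_path v), uniq (r :: root_path v) &
      last r (root_path v) = v].
Proof. by case/and3P: (xchooseP (tree_path_exists v)) => ? ? /eqP. Qed.

Lemma last_root_path v : last r (root_path v) = v.
Proof. by case: (root_pathP v). Qed.

Lemma root_path_unique p :
  path e r p -> uniq (r :: p) -> root_path (last r p) = p.
Proof.
move=> pp up; have [pp' up' E] := root_pathP (last r p).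
exact: (tree_path_uniq pp' up' pp up E).
Qed.

Lemma root_path_prefix v s :
  prefix s (root_path v) -> root_path (last r s) = s.
Proof.
case/prefixP => t E; have [] := root_pathP v.
rewrite E cat_path -cat_cons cat_uniq => /andP [ps _] /and3P [us _ _] _.
exact: root_path_unique.
Qed.

Lemma size_root_path v : size (root_path v) < #|T|.
Proof.
have [_ /card_uniqP /= E _] := root_pathP v.
exact: leq_trans (eq_leq (esym E)) (max_card _).
Qed.

Lemma root_path_inj : injective root_path.
Proof. by move=> u v E; rewrite -(last_root_path u) E last_root_path. Qed.

Lemma parentP u v : parent e r u v <-> root_path v = rcons (root_path u) v.
Proof.
split=> [[p [pp up <-]]|E].
  have := root_path_unique pp up; rewrite last_rcons => E.
  by rewrite (@root_path_prefix v p) // E prefix_rcons.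
have [pp up _] := root_pathP v; exists (root_path u).
by rewrite -E last_root_path.
Qed.

Lemma parent_exists v : v <> r -> exists u, parent e r u v.
Proof.
move=> vr; case/lastP E: (root_path v) (last_root_path v) => [|p w].
  by move=> /esym.
rewrite last_rcons => wv; exists (last r p); apply/parentP.
by rewrite (@root_path_prefix v p) ?E ?wv ?prefix_rcons.
Qed.

Lemma downward_path w s : downward e r w s ->
  forall t, prefix t s -> root_path (last w t) = root_path w ++ t.
Proof.
elim: s w => [|x s IH] w /=; first by move=> _ [|y t] // _; rewrite cats0.
case=> /parentP wx sx [|y t] /=; first by rewrite cats0.
by case/andP=> /eqP -> ts; rewrite IH // wx cat_rcons.
Qed.
End TreePaths.

Section DerivedBurlingSet.
Variables (T : finType) (e : rel T) (r : T) (lam : T -> T) (c : T -> {set T}).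
Hypothesis bt : burling_tree e r lam c.
Let eT := bt_tree bt.
Local Notation rp := (root_path eT r).

Definition tree_prec : rel T := [rel x y | prefix (rp y) (rp x) && (y != x)].

(** A non-empty [c x] rules out the root and last-borns, so the branch starts at a sibling [lam u]
    of [x]. Axioms (ii) to (iv) are read off from this description by root paths. *)
Lemma derivedP x y0 : y0 \in c x -> exists u s,
  [/\ rp x = rcons (rp u) x, lam u <> x &
    forall y, y \in c x <-> exists2 t, prefix t s & rp y = rp u ++ lam u :: t].
Proof.
move=> y0x; have cx0 : c x <> set0 by move=> E; rewrite E inE in y0x.
have xr : x <> r by move=> E; apply: cx0; apply: (bt_c0 bt); left.
have xlb : ~ last_born e r lam x.
  by move=> E; apply: cx0; apply: (bt_c0 bt); right.
have [u ux] := parent_exists eT xr.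
have [s br cE] := bt_c bt ux xlb.
have /(parentP eT) ul : parent e r u (lam u) by apply: (bt_lam bt); exists x.
case: s br cE => [_ cE|z s [-> ds] cE]; first by rewrite cE inE in y0x.
exists u, s; split; first exact/(parentP eT).
  by move=> E; apply: xlb; exists u.
move=> y; rewrite cE inE; split=> [|[t ts E]].
  rewrite inE => /predU1P [->|].
    by exists [::]; rewrite ?prefix0s // ul cats1.
  move=> ys; case/path.splitP: ys ds => p1 p2 ds; exists (rcons p1 y).
    exact: prefix_prefix.
  have := downward_path eT ds (prefix_prefix (rcons p1 y) p2).
  by rewrite last_rcons ul cat_rcons.
have := downward_path eT ds ts; rewrite ul cat_rcons -E.
move=> /(@root_path_inj _ _ eT r) <-.
by case/prefixP: ts => t' ->; rewrite -cat_cons mem_cat mem_last.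
Qed.

Lemma derived_burling_set : burling_set tree_prec (fully_derived c).
Proof.
split.
- by apply/card_gt0P; exists r.
- move=> x y /andP [/= xy nxy]; apply/negP => /andP [/= yx _].
  by case/negP: nxy; apply/eqP/(@root_path_inj _ _ eT r)/prefix_anti.
- move=> y x z /andP [/= yx nyx] /andP [/= zy nzy]; apply/andP; split=> /=.
    exact: prefix_trans zy yx.
  apply/eqP => zx; case/negP: nyx; rewrite -zx in yx *.
  by apply/eqP/(@root_path_inj _ _ eT r)/prefix_anti.
(* Vertices with empty [c] are sinks and get the top rank. An out-neighbour [y] of [x] with [c y]
   non-empty is not [lam u], so it is at least two levels below [u], and [x] only one. *)
- apply: (@rank_acyclic _ _
    (fun x => if c x == set0 then #|T| else size (rp x))) => x y.
  rewrite /fully_derived /= => yx; case: eqP => [E|_].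
    by rewrite E inE in yx.
  case: eqP => [_|cy]; first exact: size_root_path.
  have [u [s [xE _ /(_ y)[/(_ yx)[t _ yE] _]]]] := derivedP yx.
  rewrite xE yE size_rcons size_cat /= addnS ltnS.
  case: t yE => [yE|a t _]; last by rewrite /= addnS ltnS leq_addr.
  case: cy; apply: (bt_c0 bt); right; exists u; last first.
    by rewrite -(last_root_path eT r y) yE last_cat.
  by apply/(parentP eT); rewrite yE cats1 -(last_root_path eT r y) yE last_cat.
- move=> x y z /andP [/= yx _] /andP [/= zx _] /eqP yz.
  rewrite /tree_prec /= yz eq_sym yz !andbT.
  by apply/orP; rewrite orbC (prefix_comparable yx zx).
- move=> x y z; rewrite /fully_derived /= => yx zx /eqP yz.
  have [u [s [_ _ H]]] := derivedP yx.
  have [[t ts yE] [t' t's zE]] := ((H y).1 yx, (H z).1 zx).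
  rewrite /tree_prec /= yz eq_sym yz !andbT yE zE.
  apply/orP; have := prefix_comparable ts t's.
  by rewrite orbC !prefix_catr // !eqxx /= !eqxx.
- move=> x y z; rewrite /fully_derived /= => yx.
  have [u [s [xE _ /(_ y)[/(_ yx)[t _ yE] _]]]] := derivedP yx.
  rewrite /tree_prec /= xE yE -cats1 => /andP [zx nzx].
  (* A proper ancestor of [x] is at or above [u], hence a proper ancestor of [y]. *)
  case/prefix_cat_cases: zx => [zu|[[//|a w] _ [/= /andP [/eqP -> w0] zE]]].
    rewrite (prefix_trans zu (prefix_prefix _ _)) /=; apply/eqP => zy.
    move: (size_prefix zu); rewrite zy yE size_cat.
    by rewrite -[X in _ <= X]addn0 leq_add2l.
  case/eqP: nzx; apply: (@root_path_inj _ _ eT r); rewrite zE xE -cats1.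
  by case: w w0 {zE}.
- move=> x y z; rewrite /fully_derived /= => yx.
  have [u [s [xE lx H]]] := derivedP yx; have [t ts yE] := (H y).1 yx.
  rewrite /tree_prec /= yE => /andP [zy _].
  (* An ancestor of [y] is at or above [u], hence above [x], or it is on the branch from [lam u] to
     [y], hence in [c x]. *)
  case/prefix_cat_cases: zy => [zu|[[//|a w] _ [/= aE zE]]].
    right; rewrite xE -cats1 (prefix_trans zu (prefix_prefix _ _)) /=.
    apply/eqP => zx; move: (size_prefix zu).
    by rewrite zx xE size_rcons ltnn.
  left; apply/H; case/andP: aE zE => /eqP -> wt zE.
  by exists w => //; apply: prefix_trans wt ts.
Qed.
End DerivedBurlingSet.

(** * Rooted trees given by a parent function *)

Section ParentFunction.
Variables (T : finType) (r : T) (par : T -> T) (d : T -> nat).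
Hypothesis par_root : par r = r.
Hypothesis par_lt : forall v, v != r -> d (par v) < d v.

Definition par_adj : rel T :=
  [rel u v | (u != r) && (par u == v) || (v != r) && (par v == u)].

Lemma par_le v : d (par v) <= d v.
Proof. by have [->|/par_lt/ltnW] := eqVneq v r; rewrite ?par_root. Qed.

Lemma par_adj_le u v : par_adj u v -> d v <= d u -> v = par u.
Proof.
by case/orP => /andP [nr /eqP <-] //; rewrite leqNgt par_lt.
Qed.

Lemma par_adj_sym : symmetric par_adj.
Proof. by move=> u v; rewrite /par_adj /= orbC. Qed.

(** The bound on [d] keeps the path simple when a child of its end is appended. *)
Lemma par_path v : exists p,
  [/\ path par_adj r p, uniq (r :: p), last r p = v &
      forall u, u \in r :: p -> d u <= d v].
Proof.
have [n] := ubnP (d v); elim: n v => // n IH v; rewrite ltnS => dv.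
have [->|vr] := eqVneq v r.
  by exists [::]; split=> // u; rewrite inE => /eqP ->.
have [p [pp up lp dp]] := IH _ (leq_trans (par_lt vr) dv).
exists (rcons p v).
rewrite last_rcons rcons_path pp lp -rcons_cons rcons_uniq up.
split=> //=.
- by rewrite /par_adj /= vr eqxx orbT.
- by rewrite andbT; apply/negP => /dp; rewrite leqNgt par_lt.
- move=> u; rewrite -rcons_cons mem_rcons inE.
  by case/predU1P => [-> // | /dp/leq_trans]; apply; apply: par_le.
Qed.

Lemma par_tree : is_tree par_adj.
Proof.
split; first exact: par_adj_sym.
- move=> v; rewrite /par_adj /= orbb; apply/negP => /andP [/par_lt lt /eqP E].
  by rewrite E ltnn in lt.
- have cr v : connect par_adj r v.
    by have [p [pp _ lp _]] := par_path v; apply/connectP; exists p.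
  move=> u v; apply: connect_trans (cr v).
  by rewrite (sym_connect_sym par_adj_sym).
- move=> s s2 us; apply/negP => cs.
  have [x0 x0s] : exists x, x \in s.
    by case: s s2 {us cs} => // x s; exists x; rewrite mem_head.
  (* At a vertex of largest [d], both neighbours on the cycle would be its parent. *)
  case: (@arg_maxnP _ x0 (mem s) d x0s) => v vs vmax.
  case/rot_to: vs => i s' E.
  move: cs us s2; rewrite -(rot_cycle i) -(rot_uniq i) -(size_rot i) E.
  have dmax u : u \in v :: s' -> d u <= d v.
    by rewrite -E mem_rot; apply: vmax.
  case: s' {E} dmax => [|a s'] // dmax; case/lastP: s' dmax => [|s' b] // dmax.
  rewrite /= rcons_path last_rcons => /and3P [va _ bv] /and3P [_ + _] _.
  have bE : b = par v.
    apply: par_adj_le; first by rewrite par_adj_sym.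
    by apply: dmax; rewrite !inE mem_rcons mem_head !orbT.
  have -> : a = par v.
    by apply: par_adj_le => //; apply: dmax; rewrite !inE eqxx orbT.
  by rewrite bE mem_rcons mem_head.
Qed.

Lemma parent_parP u v : parent par_adj r u v <-> v != r /\ par v = u.
Proof.
have parP w : w != r -> parent par_adj r (par w) w.
  move=> wr; have [p [pp up lp dp]] := par_path (par w).
  exists p; split=> //.
    by rewrite rcons_path pp lp /par_adj /= wr eqxx orbT.
  rewrite -rcons_cons rcons_uniq up andbT; apply/negP => /dp.
  by rewrite leqNgt par_lt.
split=> [uv|[vr <-]]; last exact: parP.
have vr : v != r.
  case: uv => p [_ + _]; rewrite -rcons_cons rcons_uniq inE negb_or.
  by case/andP => /andP [].
split=> //; move: uv (parP v vr) => /(parentP par_tree) E /(parentP par_tree).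
by rewrite E => /rcons_inj [/root_path_inj].
Qed.

Lemma par_connectE u v : fconnect par u v = (u == v) || fconnect par (par u) v.
Proof.
apply/idP/orP => [/iter_findex <-|[/eqP -> // | H]]; last first.
  exact: connect_trans (fconnect1 _ _) H.
case: findex => [|n]; first by left.
by right; rewrite iterSr fconnect_iter.
Qed.

Lemma par_connect_le u v : fconnect par u v -> d v <= d u.
Proof.
move/iter_findex <-; elim: findex => //= n; apply: leq_trans; exact: par_le.
Qed.

Lemma par_connect_root v : fconnect par r v = (v == r).
Proof.
apply/idP/eqP => [/iter_findex <-|-> //].
by elim: findex => //= n ->.
Qed.

Lemma par_connect_anti u v : fconnect par u v -> fconnect par v u -> u = v.
Proof.
rewrite par_connectE => /predU1P [// | uv] /par_connect_le vu.
have := leq_trans vu (par_connect_le uv).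
have [ur|/par_lt] := eqVneq u r; last by rewrite ltnNge => /negP.
by move: uv; rewrite ur par_root par_connect_root => /eqP.
Qed.

(** Turns an interval of ancestors into a downward path, the form demanded of the choice
    function. *)
Lemma par_branch u w : fconnect par u w -> exists s,
  [/\ downward par_adj r w s, last w s = u &
      forall v, (v \in w :: s) = fconnect par u v && fconnect par v w].
Proof.
have [n] := ubnP (d u); elim: n u => // n IH u; rewrite ltnS => du uw.
have [<-|nuw] := eqVneq u w.
  exists [::]; split=> // v; rewrite inE.
  by apply/eqP/andP => [-> // | [uv vu]]; apply: par_connect_anti.
have ur : u != r.
  by apply: contraNneq nuw => E; rewrite E par_connect_root eq_sym -E in uw.
have puw : fconnect par (par u) w by rewrite par_connectE (negbTE nuw) in uw.
have [s [ds ls sE]] := IH _ (leq_trans (par_lt ur) du) puw.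
exists (rcons s u); split=> [||v]; last 1 first.
- rewrite -rcons_cons mem_rcons inE sE (par_connectE u) (eq_sym u).
  by case: eqP => //= ->.
- elim: s w ds ls {IH sE nuw uw puw} => [|x s IHs] w /=.
    by move=> _ ->; split=> //; apply/parent_parP.
  by case=> wx ds ls; split=> //; apply: IHs.
- by rewrite last_rcons.
Qed.
End ParentFunction.

(** * From Burling sets to Burling trees *)

Section CaterpillarTree.
Variables (S : finType) (prec arrow : rel S) (n : nat) (f : S -> 'I_n).
Hypothesis bs : burling_set prec arrow.
Hypothesis f_arrow : forall x y, arrow x y -> f x < f y.

Definition above x : {set S} := [set y | prec x y].

Definition up_parent x : option S :=
  [pick y in above x | [forall z in above x, (z == y) || prec y z]].

Lemma above_sub x y : prec x y -> #|above y| < #|above x|.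
Proof.
move=> xy; apply: proper_card; apply/properP; split.
  by apply/subsetP => z; rewrite !inE; apply: (bs_prec_trans bs).
by exists y; rewrite inE // (prec_irr bs).
Qed.

Lemma up_parent_some x y : up_parent x = Some y ->
  prec x y /\ forall z, prec x z -> z = y \/ prec y z.
Proof.
rewrite /up_parent; case: pickP => // z /andP [xz /forall_inP zmin] [<-].
split; first by rewrite inE in xz.
by move=> w xw; have := zmin w; rewrite inE => /(_ xw) /predU1P.
Qed.

Lemma up_parent_none x y : up_parent x = None -> ~~ prec x y.
Proof.
rewrite /up_parent; case: pickP => // none _; apply/negP => xy.
have yx : y \in above x by rewrite inE.
(* By (i) the elements above [x] form a chain; the one with most elements above it is the lowest. *)
case: (@arg_maxnP _ y (mem (above x)) (fun y => #|above y|) yx) => z.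
rewrite -[mem _ z]/(z \in above x) => zx zmax.
have /negP := none z; apply; rewrite zx /=; apply/forall_inP => w wx.
have [//|/eqP wz] := eqVneq w z.
have := zmax w wx; rewrite !inE in zx wx.
case: (bs_i bs zx wx (nesym wz)) => [-> // | /above_sub lt].
by rewrite /= leqNgt lt.
Qed.

(* [node (Some x) 0] stands for [x] itself and [node None 0] for the root;
   below [node p 0] hangs the path of the [node p i], each the last-born of its
   predecessor, and a child [x] of [p] in the forest of [prec] is attached to
   [node p (f x)]. *)
Definition node (p : option S) (i : nat) : option S * 'I_n.+1 := (p, inord i).

Definition cat_par (v : option S * 'I_n.+1) : option S * 'I_n.+1 :=
  match v.1, val v.2 with
  | None, 0 => node None 0
  | Some x, 0 => node (up_parent x) (f x)
  | p, i.+1 => node p i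
  end.

Definition cat_lam (v : option S * 'I_n.+1) := node v.1 v.2.+1.

Definition level (p : option S) := if p is Some x then #|above x|.+1 else 0.

(** A lexicographic measure rather than the depth in the tree: forest level first, spine index
    second. *)
Definition cat_depth (v : option S * 'I_n.+1) := level v.1 * n.+1 + v.2.

(** The last-born of the parent of [node (Some x) 0]; its index is at most [n] because [f x < n]. *)
Definition cat_start x := node (up_parent x) (f x).+1.

(** The ancestor interval from the out-neighbours of [x] up to [cat_start x]. A positive index marks
    a last-born, whence the empty set. *)
Definition cat_c (v : option S * 'I_n.+1) : {set option S * 'I_n.+1} :=
  if v.1 is Some x then
    if v.2 == 0 :> nat then
      [set u | [exists y, arrow x y && fconnect cat_par (node (Some y) 0) u] &&
               fconnect cat_par u (cat_start x)]
    else set0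
  else set0.

Local Notation root := (node None 0).

Lemma node_val p i : i <= n -> (node p i).2 = i :> nat.
Proof. by move=> ile; rewrite inordK. Qed.

Lemma node_eta (v : option S * 'I_n.+1) : v = node v.1 v.2.
Proof. by case: v => p i; rewrite /node inord_val. Qed.

Lemma node_inj p q i j : i <= n -> j <= n -> node p i = node q j -> i = j.
Proof. by move=> ile jle E; rewrite -(node_val p ile) -(node_val q jle) E. Qed.

Lemma cat_par0 x : cat_par (node (Some x) 0) = node (up_parent x) (f x).
Proof. by rewrite /cat_par /= inordK. Qed.

Lemma cat_parS p i : i < n -> cat_par (node p i.+1) = node p i.
Proof. by move=> lt; rewrite /cat_par /= inordK //; case: p. Qed.

Lemma cat_par_root : cat_par root = root.
Proof. by rewrite /cat_par /= inordK. Qed.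

Lemma up_parent_level x : level (up_parent x) < level (Some x).
Proof.
case E: up_parent => [y|] //=.
by rewrite ltnS above_sub //; case/up_parent_some: E.
Qed.

Lemma cat_par_lt v : v != root -> cat_depth (cat_par v) < cat_depth v.
Proof.
rewrite (node_eta v); case: v => p [[|i] ilt] /=.
  case: p => [x _|]; last by rewrite eqxx.
  rewrite cat_par0 /cat_depth /= !inordK ?addn0 // ?(leqW (ltn_ord _)) //.
  apply: leq_trans (_ : (level (up_parent x)).+1 * n.+1 <= _).
    by rewrite mulSn addnC ltn_add2r leqW // ltn_ord.
  by rewrite leq_mul2r up_parent_level orbT.
move=> _; rewrite cat_parS // /cat_depth /= !inordK ?ltn_add2l //.
exact: ltnW.
Qed.

Lemma connect_spine p i j : i <= j <= n ->
  fconnect cat_par (node p j) (node p i).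
Proof.
case/andP => /subnK <-; elim: (j - i) => // k IH ltn.
apply: connect_trans (fconnect1 _ _) _.
by rewrite addSn cat_parS //; apply: IH; apply: ltnW.
Qed.

Lemma connect_up_parent x :
  fconnect cat_par (node (Some x) 0) (node (up_parent x) 0).
Proof.
apply: connect_trans (fconnect1 _ _) _; rewrite cat_par0.
by apply: connect_spine; rewrite /= ltnW.
Qed.

Lemma connect_prec x y : prec x y ->
  fconnect cat_par (node (Some x) 0) (node (Some y) 0).
Proof.
have [k] := ubnP #|above x|; elim: k x => // k IH x; rewrite ltnS => xk xy.
have := connect_up_parent x; case E: up_parent => [z|]; last first.
  by have := up_parent_none y E; rewrite xy.
have [xz /(_ _ xy) [-> //|zy]] := up_parent_some E.
by move/connect_trans; apply; apply: IH zy; apply: leq_trans (above_sub xz) xk.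
Qed.

Lemma connect_node_prec y u x i :
  fconnect cat_par (node (Some y) 0) u ->
  u = node (Some x) i -> x = y \/ prec y x.
Proof.
move/iter_findex <-; elim: findex x i => [|k IH] x i /=.
  by case=> ->; left.
move: (iter k _ _) IH => [[z|] [[|j] jlt]] IH //.
- rewrite /cat_par /= => -[E _]; have [zx _] := up_parent_some E.
  have /IH : (Some z, Ordinal jlt) = node (Some z) 0.
    by rewrite [LHS]node_eta.
  by case=> [<-|/(bs_prec_trans bs)/(_ zx)]; right.
- rewrite /cat_par /= => -[zx _]; apply: (IH x j.+1).
  by rewrite [LHS]node_eta /= zx.
Qed.

(** Climb from [y]: by (iv) its forest parent is again an out-neighbour of [x] or lies above [x]. In
    the latter case, or if there is no parent, (iii) makes [x] and [y] siblings, and [f x < f y]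
    attaches [y] at or beyond [cat_start x] on their common spine. *)
Lemma arrow_connect x y : arrow x y ->
  fconnect cat_par (node (Some y) 0) (cat_start x).
Proof.
have [k] := ubnP #|above y|; elim: k y => // k IH y; rewrite ltnS => yk xy.
case E: (up_parent y) => [z|]; last first.
  have -> : cat_start x = node (up_parent y) (f x).+1.
    congr node; case Ex: up_parent => [w|//]; have [xw _] := up_parent_some Ex.
    by have := up_parent_none w E; rewrite (bs_iii bs xy xw).
  apply: connect_trans (fconnect1 _ _) _; rewrite cat_par0.
  by apply: connect_spine; rewrite f_arrow // ltnW.
have [yz zmin] := up_parent_some E.
have [xz|xz] := bs_iv bs xy yz.
  apply: connect_trans (connect_prec yz) _.
  by apply: IH => //; apply: leq_trans (above_sub yz) yk.
have -> : cat_start x = node (up_parent y) (f x).+1.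
  congr node; case Ex: up_parent => [w|]; last first.
    by have := up_parent_none z Ex; rewrite xz.
  have [xw wmin] := up_parent_some Ex; rewrite E; congr Some.
  have [//|zw] := zmin _ (bs_iii bs xy xw).
  have [// |wz] := wmin _ xz.
  by have := bs_prec_asym bs wz; rewrite zw.
apply: connect_trans (fconnect1 _ _) _; rewrite cat_par0.
by apply: connect_spine; rewrite f_arrow // ltnW.
Qed.

Lemma cat_cE x y : (node (Some y) 0 \in cat_c (node (Some x) 0)) = arrow x y.
Proof.
rewrite /cat_c /= inordK // inE; apply/andP/idP =>
  [[/exists_inP [z xz zy] ys]|xy].
  case: (connect_node_prec zy erefl) => [-> // |zy'].
  (* The alternative to an arrow is [prec x y]; then [y] is the forest parent of [x] or above it,
     too high to have [cat_start x] as an ancestor. *)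
  case: (bs_iv bs xz zy') => // xy.
  case E: (up_parent x) => [w|]; last by have := up_parent_none y E; rewrite xy.
  have [xw wmin] := up_parent_some E.
  case: (connect_node_prec ys (f_equal (fun p => node p _) E)) => [wy|yw].
    have := par_connect_le cat_par_root cat_par_lt ys.
    rewrite /cat_start E wy /cat_depth /= !inordK // ?leq_add2l //.
    by rewrite ltnS.
  case: (wmin _ xy) => [yw'|wy]; first by rewrite yw' (prec_irr bs) in yw.
  by have := bs_prec_asym bs wy; rewrite yw.
split; last exact: arrow_connect.
by apply/exists_inP; exists y.
Qed.

(** The out-neighbours form a chain by (ii). The interval of the lowest one contains all the others,
    so [cat_c] is a single branch. *)
Lemma cat_bottom x y0 : arrow x y0 ->
  exists2 y, arrow x y & forall z, arrow x z -> z = y \/ prec y z.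
Proof.
move=> xy0.
case: (@arg_maxnP _ y0 (arrow x) (fun y => #|above y|) xy0) => y xy ymax.
exists y => // z xz; have [->|/eqP zy] := eqVneq z y; [by left|right].
case: (bs_ii bs xz xy zy) => // /above_sub; rewrite ltnNge.
by rewrite (ymax z xz : #|_| <= _).
Qed.

Lemma cat_burling_tree :
  burling_tree (par_adj root cat_par) root cat_lam cat_c.
Proof.
have parentE u v : parent (par_adj root cat_par) root u v <->
    v != root /\ cat_par v = u.
  exact: parent_parP cat_par_root cat_par_lt u v.
have lamP (u : option S * 'I_n.+1) : u.2 < n ->
    cat_lam u != root /\ cat_par (cat_lam u) = u.
  move=> lt; split; last by rewrite /cat_lam cat_parS // -node_eta.
  by apply/eqP => /node_inj E; have := E lt (leq0n _).
(* As [f x < n], index [n] occurs only at leaves, so [inord] does not overflow in the last-born of a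
   vertex with children. *)
have par_lt (v : option S * 'I_n.+1) : v != root -> (cat_par v).2 < n.
  rewrite (node_eta v); case: v => p [[|i] ilt] /=.
    case: p => [x _|]; last by rewrite eqxx.
    by rewrite cat_par0 node_val // ltnW.
  by move=> _; rewrite cat_parS // node_val // ltnW.
split.
- exact: par_tree cat_par_root cat_par_lt.
- by move=> u [v /parentE [vr <-]]; apply/parentE/lamP/par_lt.
- move=> u v /parentE [vr vu] nlb.
  have v0 : v.2 = 0 :> nat.
    case: v => p [[|i] ilt] // in vr vu nlb *; case: nlb.
    exists u; first exact/parentE.
    rewrite -vu (node_eta (p, Ordinal ilt)) /= cat_parS //.
    by rewrite /cat_lam /= inordK // ltnW.
  move: vr vu nlb; rewrite (node_eta v) v0.
  case: (v.1) => [x|]; last by rewrite eqxx.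
  rewrite cat_par0 => _ <- _.
  have -> : cat_lam (node (up_parent x) (f x)) = cat_start x.
    by rewrite /cat_lam node_val // ltnW.
  rewrite /cat_c /= inordK //.
  have [y0 xy0|no] := pickP (arrow x); last first.
    exists [::] => //; apply/setP => w; rewrite !inE.
    by apply/negP => /andP [/exists_inP [z]]; have := no z; rewrite /= => ->.
  have [y xy ymin] := cat_bottom xy0.
  have [s [ds _ sE]] := par_branch cat_par_root cat_par_lt (arrow_connect xy).
  exists (cat_start x :: s) => //; apply/setP => w; rewrite inE [RHS]inE sE.
  congr (_ && _); apply/exists_inP/idP => [[z xz zw]|yw]; last by exists y.
  by case: (ymin z xz) => [<- // | /connect_prec/connect_trans]; apply.
- move=> v [->|[u /parentE [vr vu] lu]] //.
  have lt : (cat_par v).2 < n by apply: par_lt.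
  rewrite -lu /cat_c /= inordK; last by rewrite ltnS -vu.
  by case: (u.1).
Qed.
End CaterpillarTree.

(** * Equality of the classes *)

Lemma isomorphic_refl (T : finType) (e : rel T) : isomorphic e e.
Proof. by exists id => //; exists id. Qed.

Lemma derived_abstract (D : ograph) : derived_ograph D -> abstract_burling D.
Proof.
case=> T [e [r [lam [c [bt /isomorphic_induced [g gI gE]]]]]].
exists D, (relpre g (tree_prec bt)), (@Defs.arc D); split.
  exact: burling_set_inj (overt_gt0 D) gI gE (derived_burling_set bt).
exact: isomorphic_refl.
Qed.

Lemma abstract_derived (D : ograph) : abstract_burling D -> derived_ograph D.
Proof.
case=> S [prec [arrow [bs [h hbij hE]]]].
have [f fE] := acyclic_rank (bs_arrow_acyclic bs).
do 5 eexists; split; first exact: cat_burling_tree bs fE.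
apply/isomorphic_induced; exists (fun x => node #|S| (Some (h x)) 0).
  by move=> x y [] /(bij_inj hbij).
by move=> x y; rewrite /fully_derived /= cat_cE.
Qed.

Lemma abstract_burling_burling_graph (G : sgraph) :
  abstract_burling_underlying G -> burling_graph G.
Proof.
case=> D [S [prec [arrow [bs [h hbij hE]]]]] [h' h'bij h'E].
have [k [g [gI gE _]]] := stab_embedding_exists bs setT.
exists k; apply/isomorphic_induced; exists (fun x => g (h (h' x))).
  by move=> x y /gI/(bij_inj hbij)/(bij_inj h'bij); apply; rewrite inE.
by move=> x y; rewrite gE ?inE // !hE -h'E.
Qed.

(** The arrow of the Burling set on the sequence, pulled back to [G], orients it. *)
Lemma burling_graph_abstract_burling (G : sgraph) :
  burling_graph G -> abstract_burling_underlying G.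
Proof.
case=> k /isomorphic_induced [g gI gE].
have [prec [arrow [bs adjE _]]] := burling_seq_burling_set k.
have bsG := burling_set_inj (svert_gt0 G) gI (fun x y => erefl) bs.
exists (OGraph (arrow_asym bsG) (svert_gt0 G)).
  exists G, (relpre g prec), (relpre g arrow); split=> //.
  exact: isomorphic_refl.
exists id; first by exists id.
by move=> x y; rewrite -gE adjE.
Qed.

Theorem theorem5p7 :
  (forall D : ograph, abstract_burling D <-> derived_ograph D) /\
  (forall G : sgraph, abstract_burling_underlying G <-> derived_graph G) /\
  (forall G : sgraph, derived_graph G <-> burling_graph G).
Proof.
have iff_oriented D : abstract_burling D <-> derived_ograph D.
  by split; [apply: abstract_derived | apply: derived_abstract].
have iff_underlying G : abstract_burling_underlying G <-> derived_graph G.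
  by split=> -[D /iff_oriented]; exists D.
split=> //; split=> // G; split=> [/iff_underlying|].
  exact: abstract_burling_burling_graph.
by move/burling_graph_abstract_burling/iff_underlying.
Qed.
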